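(* Let $(\Phi,\rho)$ be a periodic realization of a $d$-dimensional crystal lattice $X$, let $\nu$ be a probability measure on $[0,\infty)$ with $\mathbb{E}\big[\min\{t_1,\dots,t_{l_X}\}^d\big]<\infty$ (where $t_1,\dots,t_{l_X}$ are i.i.d. with law $\nu$ and $l_X$ is the edge connectivity of $X$), and let $\mathcal{B}_\Phi\subset\mathbb{R}^d$ be the limit shape of the first passage percolation model on $X$ with time distribution $\nu$. Let $M(d)=\mathbb{R}^d\rtimes O(d)$ be the group of congruent transformations of $\mathbb{R}^d$, where $(\mathbf{b},A)$ acts by $v\mapsto Av+\mathbf{b}$, let $$\operatorname{Sym}(\Phi(X))=\{g\in M(d): g\Phi(X)=\Phi(X)\}$$ be the symmetric group of the image $\Phi(X)$, and let $p:\operatorname{Sym}(\Phi(X))\to O(d)$ be the group homomorphism $(\mathbf{b},A)\mapsto A$. Then for any $A\in\operatorname{Im}(p)$, $A\mathcal{B}_\Phi=\mathcal{B}_\Phi$. In other words, the limit shape $\mathcal{B}_\Phi$ has the symmetry given by $\operatorname{Im}(p)$.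
   Context: Graphs. A graph $X=(V,E)$ consists of disjoint sets $V,E$, a map $E\to V\times V$, $e\mapsto(o(e),t(e))$, and an involution $e\mapsto\bar e$ of $E$ with $\bar e\neq e$, $o(\bar e)=t(e)$, $t(\bar e)=o(e)$ (loops and parallel edges are allowed). A group $G$ acts freely on $X$ if it acts by graph automorphisms, the action on $V$ is free, and $ge\neq\bar e$ for all $g\in G$, $e\in E$; the quotient graph $X/G$ has vertex set $V/G$ and edge set $E/G$. A $d$-dimensional crystal lattice is a connected graph $X$ with a free action of a free abelian group $L$ of rank $d$ (the abstract period lattice) such that the quotient graph $X/L$ is finite. For percolation purposes $e$ and $\bar e$ are identified. The edge connectivity $l_X$ is the minimum number of (undirected) edges that separate $X$. Realizations. A periodic realization $(\Phi,\rho)$ is a map $\Phi:V\to\mathbb{R}^d$, with edges realized as the segments connecting their endpoints, together with an injective homomorphism $\rho:L\to\mathbb{R}^d$ (the period homomorphism) such that $\Gamma:=\rho(L)$ is a lattice group (the integer span of a basis of $\mathbb{R}^d$) and $\Phi(\sigma x)=\Phi(x)+\rho(\sigma)$ for all $x\in V$, $\sigma\in L$. $\Phi(X)$ denotes the image of the realization (the realized crystal). The realization is nondegenerate if $\Phi$ is injective on $V$. First passage percolation. Edges $e$ carry i.i.d. passage times $t_e$ with law $\nu$; for a path $\gamma=(e_1,\dots,e_r)$, $T(\gamma)=\sum_{i=1}^r t_{e_i}$. For a nondegenerate realization and $x,y\in\mathbb{R}^d$, $T(x,y)$ is the infimum of $T(\gamma)$ over paths $\gamma$ from $x'$ to $y'$,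 where $x',y'\in V$ are the vertices whose images under $\Phi$ are closest to $x,y$, respectively. Let $\mathcal{D}$ be the set of rational linear combinations of a basis of $\Gamma$. For $x\in\mathcal{D}$, $\mu(x)$ is the almost sure, deterministic limit $\lim_{n\to\infty}T(0,nx)/n$; $\mu$ is extended continuously to $\mathbb{R}^d$. The limit shape is $\mathcal{B}_\Phi=\{x\in\mathbb{R}^d:\mu(x)\le1\}$ (this is all of $\mathbb{R}^d$ when $\nu(\{0\})\ge p_c(X)$, the critical probability of independent bond percolation on $X$). The limit shape depends only on $X$, $\nu$ and the period homomorphism $\rho$; for a degenerate realization $(\Phi,\rho)$, $\mathcal{B}_\Phi$ is the limit shape $\mathcal{B}_{\Phi'}$ of any nondegenerate periodic realization $(\Phi',\rho')$ of $X$ with $\rho'=\rho$.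
   Formalization: Sym(Φ(X)) is restricted to congruences g with gΦ(X)=Φ(X) that are induced by an automorphism f of X (gΦ=Φf); with equality of images alone the claim fails, e.g. Z² with horizontal edges subdivided and ν=δ_1, where μ(x,y)=2|x|+|y|. *)

(* Defs.v *)
From HB Require Import structures.
From mathcomp Require Import all_boot all_order all_algebra.
From mathcomp Require Import all_classical all_reals all_analysis.
Set Implicit Arguments.
Unset Strict Implicit.
Unset Printing Implicit Defensive.
Import Order.TTheory GRing.Theory Num.Theory.
Import numFieldNormedType.Exports.
Local Open Scope classical_set_scope.
Local Open Scope ring_scope.

(** * Graphs *)

Record graph := Graph {
  vertex : choiceType;
  edge : choiceType;
  src : edge -> vertex;
  tgt : edge -> vertex;
  rev : edge -> edge;
  revK : involutive rev;
  rev_neq : forall e, rev e <> e;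
  src_rev : forall e, src (rev e) = tgt e;
  tgt_rev : forall e, tgt (rev e) = src e }.

Fixpoint is_path (X : graph) (x : vertex X) (p : seq (edge X)) (y : vertex X) :
    Prop :=
  if p is e :: p' then src e = x /\ is_path (tgt e) p' y else x = y.

Definition graph_connected (X : graph) : Prop :=
  [set: vertex X] !=set0 /\ forall x y : vertex X, exists p, is_path x p y.

(* Removing an oriented edge removes its reverse as well. *)
Definition separates (X : graph) (s : seq (edge X)) : Prop :=
  exists x y : vertex X, forall p, is_path x p y ->
    exists2 e, e \in p & (e \in s) || (rev e \in s).

Definition edge_connectivity (X : graph) (l : nat) : Prop :=
  (exists2 s : seq (edge X), separates s & size s = l) /\
  forall s : seq (edge X), separates s -> (l <= size s)%N.

Definition graph_automorphism (X : graph) (f : vertex X -> vertex X)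
    (h : edge X -> edge X) : Prop :=
  [/\ bijective f, bijective h, forall e, src (h e) = f (src e),
      forall e, tgt (h e) = f (tgt e) & forall e, h (rev e) = rev (h e)].

(** * Crystal lattices *)

Definition free_abelian_of_rank (L : zmodType) (d : nat) : Prop :=
  exists b : 'I_d -> L,
    bijective (fun c : {ffun 'I_d -> int} => \sum_i b i *~ c i).

Definition is_action (L : zmodType) (T : Type) (act : L -> T -> T) : Prop :=
  (forall x, act 0 x = x) /\ (forall a b x, act (a + b) x = act a (act b x)).

Definition orbit_of (L T : Type) (act : L -> T -> T) (x : T) : set T :=
  [set act a x | a in [set: L]].

Definition orbits (L T : Type) (act : L -> T -> T) : set (set T) :=
  range (orbit_of act).

Record crystal_lattice (d : nat) := CrystalLattice {
  lattice_graph :> graph;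
  period : zmodType;
  actV : period -> vertex lattice_graph -> vertex lattice_graph;
  actE : period -> edge lattice_graph -> edge lattice_graph;
  lattice_connected : graph_connected lattice_graph;
  period_free : free_abelian_of_rank period d;
  actV_action : is_action actV;
  actE_action : is_action actE;
  act_src : forall a e, src (actE a e) = actV a (src e);
  act_tgt : forall a e, tgt (actE a e) = actV a (tgt e);
  act_rev : forall a e, actE a (rev e) = rev (actE a e);
  actV_free : forall a x, actV a x = x -> a = 0;
  act_noinversion : forall a e, actE a e <> rev e;
  quotient_vertices_finite : finite_set (orbits actV);
  quotient_edges_finite : finite_set (orbits actE) }.

(** * Periodic realizations *)

Section Realization.
Context (R : realType) (d : nat) (X : crystal_lattice d).
Implicit Types (Phi : vertex X -> 'cV[R]_d) (rho : period X -> 'cV[R]_d).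

(* The columns of [M] form a basis of R^d whose integer span is rho(L). *)
Definition lattice_basis rho (M : 'M[R]_d) : Prop :=
  M \in unitmx /\
  range rho = [set M *m map_mx intr c | c in [set: 'cV[int]_d]].

Definition periodic_realization Phi rho : Prop :=
  [/\ forall a b, rho (a + b) = rho a + rho b, injective rho,
      exists M, lattice_basis rho M &
      forall a x, Phi (actV a x) = Phi x + rho a].

Definition nondegenerate Phi : Prop := injective Phi.

Definition rational_points rho : set 'cV[R]_d :=
  [set x | exists M, lattice_basis rho M /\
     exists q : 'cV[rat]_d, x = M *m map_mx ratr q].

(* Euclidean norm; the library norm on matrices is the sup norm. *)
Definition enorm (x : 'cV[R]_d) : R := Num.sqrt (\sum_i x i 0 ^+ 2).

(* [closest] is an arbitrary rule choosing, for each point of R^d, one of the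
   closest realized vertices. *)
Definition nearest_vertex Phi (closest : 'cV[R]_d -> vertex X) : Prop :=
  forall x v, enorm (Phi (closest x) - x) <= enorm (Phi v - x).

(** ** Symmetries *)

(* (b, A) stands for v |-> A v + b. *)
Definition congruent_transformations : set ('cV[R]_d * 'M[R]_d) :=
  [set g | g.2 *m g.2^T = 1%:M].

Definition move (g : 'cV[R]_d * 'M[R]_d) (v : 'cV[R]_d) : 'cV[R]_d :=
  g.2 *m v + g.1.

Definition realized_segment Phi (e : edge X) : set 'cV[R]_d :=
  [set (1 - s) *: Phi (src e) + s *: Phi (tgt e) | s in `[0, 1]].

Definition realized_image Phi : set 'cV[R]_d :=
  range Phi `|` \bigcup_(e in [set: edge X]) realized_segment Phi e.

(* g Phi(X) = Phi(X) is an equality of realized graphs, i.e. of the realizations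
   g o Phi and Phi up to relabelling by an automorphism of X. Equality of the
   underlying point sets is not enough: subdividing the horizontal edges of the
   square lattice, or doubling them, does not change the point set, but in general
   destroys the invariance of the limit shape under the quarter turn. *)
Definition symmetric_group Phi : set ('cV[R]_d * 'M[R]_d) :=
  [set g | [/\ congruent_transformations g,
     move g @` realized_image Phi = realized_image Phi &
     exists f h, @graph_automorphism X f h /\
       forall x, move g (Phi x) = Phi (f x)]].

Definition point_symmetries Phi : set 'M[R]_d := snd @` symmetric_group Phi.

End Realization.

(** * First passage percolation *)

Section Percolation.
Context (R : realType).

Definition iid_on (dT : measure_display) (T : measurableType dT)
    (P : probability T R) (nu : probability (measurableTypeR R) R)
    (I : choiceType) (D : set I) (Y : I -> {RV P >-> R}) : Prop :=
  (forall i, D i -> forall B : set R, measurable B ->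
     distribution P (Y i) B = nu B) /\
  (forall s : seq I, uniq s -> [set` s] `<=` D ->
     forall B : I -> set R, (forall i, measurable (B i)) ->
     P (\bigcap_(i in [set` s]) (Y i @^-1` B i)) =
     (\prod_(i <- s) P (Y i @^-1` B i))%E).

(* E[min(t_1, ..., t_l)^k] < oo for t_1, ..., t_l i.i.d. of law nu. *)
Definition finite_min_moment (nu : probability (measurableTypeR R) R)
    (l k : nat) : Prop :=
  exists (dT : measure_display) (T : measurableType dT) (P : probability T R)
    (Y : 'I_l -> {RV P >-> R}),
    iid_on nu [set: 'I_l] Y /\
    (\int[P]_w ((\big[mine/+oo]_(i < l) (Y i w)%:E) ^+ k) < +oo)%E.

Context (dT : measure_display) (T : measurableType dT) (P : probability T R).

(* The passage times are attached to the undirected edges {e, rev e}: they are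
   i.i.d. on every set of edges that contains at most one of e and rev e. *)
Definition iid_passage_times (X : graph)
    (nu : probability (measurableTypeR R) R) (t : edge X -> {RV P >-> R}) :
    Prop :=
  (forall e w, t (rev e) w = t e w) /\
  forall D : set (edge X), (forall e, D e -> ~ D (rev e)) -> iid_on nu D t.

Definition passage_time (X : graph) (t : edge X -> {RV P >-> R})
    (x y : vertex X) (w : T) : \bar R :=
  ereal_inf [set (\sum_(e <- p) t e w)%:E | p in [set p | is_path x p y]].

Context (d : nat) (X : crystal_lattice d).
Implicit Types (Phi : vertex X -> 'cV[R]_d) (rho : period X -> 'cV[R]_d).
Implicit Types (t : edge X -> {RV P >-> R}).

Definition time_constant rho t (closest : 'cV[R]_d -> vertex X)
    (mu : 'cV[R]_d -> R) : Prop :=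
  continuous mu /\
  forall x, rational_points rho x ->
    {ae P, forall w,
      (passage_time t (closest 0%R) (closest (n%:R *: x)%R) w * (n%:R^-1)%:E)%E
        @[n --> \oo] --> (mu x)%:E}.

(* [Phi'] is [Phi] itself when [Phi] is nondegenerate, and otherwise any
   nondegenerate realization with the same period homomorphism. *)
Definition limit_shape Phi rho t (B : set 'cV[R]_d) : Prop :=
  exists (Phi' : vertex X -> 'cV[R]_d) (closest : 'cV[R]_d -> vertex X)
    (mu : 'cV[R]_d -> R),
    [/\ periodic_realization Phi' rho /\ nondegenerate Phi',
        nondegenerate Phi -> Phi' = Phi,
        nearest_vertex Phi' closest,
        time_constant rho t closest mu &
        B = [set x | mu x <= 1]].

End Percolation.

(* Main.v *)
Require Import Defs.
From HB Require Import structures.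
From mathcomp Require Import all_boot all_order all_algebra.
From mathcomp Require Import all_classical all_reals all_analysis.
From mathcomp Require Import lra zify.
Set Implicit Arguments.
Unset Strict Implicit.
Unset Printing Implicit Defensive.
Import Order.TTheory GRing.Theory Num.Theory.
Import numFieldNormedType.Exports.
Local Open Scope classical_set_scope.
Local Open Scope ring_scope.

(* Let f be the automorphism of X realizing v |-> A v + b, and c(y) the vertex
   nearest to y. It suffices to show mu(A x) <= mu(x) for rational x: density and
   continuity give all x, and the inverse symmetry gives the converse inequality.
   The passage times T(c(0), c(n x)) and T(f c(0), f c(n x)) have the same law,
   since f permutes the i.i.d. edge times. Some n x and n A x are both periods, as
   A maps a multiple of each period to a period. Along the multiples of this n,
   the vertices f c(n x) and c(n A x) are translates, by a common period, of
   vertices in a fixed finite set, so T(f c(n x), c(n A x)) / n tends to 0 in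
   probability. The triangle inequality then compares T(c(0), c(n A x)) / n with
   T(f c(0), f c(n x)) / n in probability, hence their limits in probability
   mu(A x) and mu(x). *)

(** * Events of vanishing probability, and laws of i.i.d. families *)

Section Vanishing.
Context (R : realType) (dT : measure_display) (T : measurableType dT).
Context (P : probability T R).
Implicit Types B C : nat -> set T.

(** Convergence of [P (B k)] to 0, written with eventual strict bounds. It expresses convergence in
    probability and, unlike an almost sure statement, survives replacing each [B k] by an event of
    the same law. *)
Definition vanishing B : Prop :=
  (forall k, measurable (B k)) /\
  forall eta : R, 0 < eta -> \forall k \near \oo, (P (B k) < eta%:E)%E.

(** [B k] lies in the tail union from [k] on; these unions decrease to the limsup of the events,
    which is null by hypothesis, so continuity from above applies. *)
Lemma vanishing_ae B : (forall k, measurable (B k)) ->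
  {ae P, forall w, \forall k \near \oo, ~ B k w} -> vanishing B.
Proof.
move=> mB [N [mN N0 sN]]; split=> // eta eta0.
have mU n : measurable (\bigcup_(k >= n) B k).
  by apply: bigcup_measurable => k _; exact: mB.
have cB : P (\bigcup_(k >= n) B k) @[n --> \oo] --> P (lim_sup_set B).
  apply: lim_sup_set_cvg => //.
  by rewrite (le_lt_trans (probability_le1 P (mU 0%N)))// ltry.
have limN : lim_sup_set B `<=` N.
  move=> w limw; apply: sN => /= -[n _ Bn].
  by have [k /= nk] := limw n I; exact: Bn.
have lim0 : P (lim_sup_set B) = 0%E.
  apply/eqP; rewrite eq_le measure_ge0 andbT -N0 le_measure// inE//.
  by apply: bigcap_measurable => // k _.
rewrite lim0 in cB.
have : \forall n \near \oo, (P (\bigcup_(k >= n) B k) < eta%:E)%E.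
  apply: (cB [set u | (u < eta%:E)%E]).
  by apply: open_ereal_lt'; rewrite lte_fin.
apply: filterS => n; apply: le_lt_trans; rewrite le_measure ?inE//.
by move=> w Bw; exists n => /=.
Qed.

Lemma vanishing_eventually B : (forall k, measurable (B k)) ->
  (forall w, \forall k \near \oo, ~ B k w) -> vanishing B.
Proof.
by move=> mB evB; apply: vanishing_ae => //; exact: aeW.
Qed.

(** Only probabilities are compared, not the sets themselves, so that [C k] may be built from other
    passage times with the same law. *)
Lemma vanishing_le B C : (forall k, measurable (B k)) ->
  (\forall k \near \oo, (P (B k) <= P (C k))%E) -> vanishing C -> vanishing B.
Proof.
move=> mB BC [mC vC]; split=> // eta /vC; apply: filterS2 BC => k.
exact: le_lt_trans.
Qed.

Lemma vanishingU B C : vanishing B -> vanishing C ->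
  vanishing (fun k => B k `|` C k).
Proof.
move=> [mB vB] [mC vC]; split=> [k|eta eta0]; first exact: measurableU.
have eta2 : 0 < eta / 2 by rewrite divr_gt0.
near=> k.
apply: (le_lt_trans (measureU2 _ _ _)) => //.
rewrite (splitr eta) EFinD lteD//.
  by near: k; exact: vB.
by near: k; exact: vC.
Unshelve. all: by end_near. Qed.

(** The selected index may vary arbitrarily with [k]: a finite list of families admits one threshold
    valid for all of them. *)
Lemma vanishing_finite (I : eqType) (s : seq I) (B : I -> nat -> set T)
    (j : nat -> I) : (forall i, i \in s -> vanishing (B i)) ->
  (forall k, j k \in s) -> vanishing (fun k => B (j k) k).
Proof.
move=> vB js; split=> [k|eta eta0]; first by have [] := vB _ (js k).
suff : \forall k \near \oo, forall i, i \in s -> (P (B i k) < eta%:E)%E.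
  by apply: filterS => k; apply.
elim: s vB {js} => [|i s IHs] vB; first by apply: nearW => k i.
have vi : \forall k \near \oo, (P (B i k) < eta%:E)%E.
  by have [_] := vB i (mem_head _ _); apply.
have vs : \forall k \near \oo, forall i, i \in s -> (P (B i k) < eta%:E)%E.
  by apply: IHs => i' i's; apply: vB; rewrite inE i's orbT.
by apply: filterS2 vi vs => k Bi Bs i'; rewrite inE => /predU1P[->//|/Bs].
Qed.

End Vanishing.

Section Law.
Context (R : realType) (I : choiceType) (D : set I).

(** Only coordinates in [D] are constrained, so the generated sigma-algebra sees nothing outside
    [D]. This matters because [t e] and [t (rev e)] are not independent. *)
Definition cylinders : set (set (I -> R)) :=
  [set C | exists (s : seq I) (B : I -> set R),
    [/\ uniq s, [set` s] `<=` D, forall i, measurable (B i) &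
        C = \bigcap_(i in [set` s]) [set y | B i (y i)]]].

Lemma cylinders_setI : setI_closed cylinders.
Proof.
move=> _ _ [s [B [us sD mB ->]]] [s' [B' [us' sD' mB' ->]]].
exists (undup (s ++ s')).
(* An index absent from one list is unconstrained by that cylinder, hence the default [setT]. *)
exists (fun i => (if i \in s then B i else setT) `&`
                 (if i \in s' then B' i else setT)).
split; first exact: undup_uniq.
- move=> i /=; rewrite mem_undup mem_cat => /orP[si|si]; first exact: sD.
  exact: sD'.
- by move=> i; apply: measurableI; case: ifP.
- apply/seteqP; split=> y.
    move=> [By B'y] i /=; rewrite mem_undup mem_cat => _.
    by split; case: ifP => // si; [exact: By|exact: B'y].
  move=> By; split=> i /= si.
    by have [] := By i; rewrite /= ?mem_undup ?mem_cat ?si.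
  by have [] := By i; rewrite /= ?mem_undup ?mem_cat ?si ?orbT.
Qed.

Lemma cylindersT : cylinders setT.
Proof.
exists [::], (fun=> setT); split=> //.
by apply/seteqP; split=> // y _ i.
Qed.

Lemma measurable_coordinate i : D i ->
  measurable_fun [set: g_sigma_algebraType cylinders]
    (fun y : g_sigma_algebraType cylinders => (y : I -> R) i).
Proof.
move=> Di _ B mB; rewrite setTI; apply: sub_sigma_algebra.
exists [:: i], (fun=> B); split=> //.
  by move=> j /=; rewrite inE => /eqP ->.
apply/seteqP; split=> y /= By; first by move=> j /=; rewrite inE => /eqP ->.
by apply: (By i); rewrite /= inE.
Qed.

Context (dT : measure_display) (T : measurableType dT) (P : probability T R).

Definition process (Y : I -> {RV P >-> R}) (w : T) :
  g_sigma_algebraType cylinders := fun i => Y i w.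

Lemma measurable_process (Y : I -> {RV P >-> R}) :
  measurable_fun [set: T] (process Y).
Proof.
apply: (@measurability _ _ _ _ setT (process Y) cylinders) => //
  _ [_ [s [B [us sD mB ->]]] <-].
rewrite setTI (_ : _ @^-1` _ = \bigcap_(i in [set` s]) (Y i @^-1` B i)) //.
apply: fin_bigcap_measurable => // i _.
by rewrite -[X in measurable X]setTI; exact: measurable_funPT.
Qed.

(** The two pushforward measures agree on cylinders by the product formula. Cylinders are closed
    under intersection, so uniqueness of measures extends this to the generated sigma-algebra. *)
Lemma iid_on_law (nu : probability (measurableTypeR R) R)
    (Y Z : I -> {RV P >-> R}) : iid_on nu D Y -> iid_on nu D Z ->
  forall C, <<s cylinders >> C -> P (process Y @^-1` C) = P (process Z @^-1` C).
Proof.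
move=> [lawY indY] [lawZ indZ] C sC.
pose m Y' := pushforward P (process Y').
have mP Y' := measurable_process Y'.
apply: (@measure_unique _ R (g_sigma_algebraType cylinders) cylinders
  (fun=> setT) _ _ _ _ (pushforward P (process Y)) (pushforward P (process Z))
  _ _ C) => //.
- exact: cylinders_setI.
- by move=> _; exact: cylindersT.
- by rewrite bigcup_const//; exists 0%N.
- move=> _ [s [B [us sD mB ->]]].
  have := indY s us sD B mB; rewrite (_ : \bigcap_(i in _) _ =
    process Y @^-1` (\bigcap_(i in [set` s]) [set y | B i (y i)])) // => E.
  have := indZ s us sD B mB; rewrite (_ : \bigcap_(i in _) _ =
    process Z @^-1` (\bigcap_(i in [set` s]) [set y | B i (y i)])) // => E'.
  rewrite /pushforward; rewrite [LHS]E [RHS]E' {E E'}.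
  rewrite !big_seq; apply: eq_bigr => i si.
  have := lawY i (sD _ si) (B i) (mB i).
  by rewrite -(lawZ i (sD _ si) (B i) (mB i)).
- by move=> _; exact: le_lt_trans (probability_le1 P measurableT) (ltry _).
Qed.

End Law.

(** * Geometry of periodic realizations *)

Lemma countable_seq (I : Type) :
  countable [set: I] -> countable [set: seq I].
Proof.
move=> /countable_injP[f injf].
have mapI : injective (map f) by apply: inj_map => i j; apply: injf; rewrite inE.
apply/countable_injP; exists (fun s => pickle (map f s)) => s s' _ _.
by move=> /(pcan_inj pickleK)/mapI.
Qed.

Lemma finite_bounded_int (d K : nat) :
  finite_set [set c : 'cV[int]_d | forall i, (`|c i 0%R|%N <= K)%N].
Proof.
pose g (u : {ffun 'I_d -> 'I_((K + K).+1)}) : 'cV[int]_d :=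
  \col_i ((u i : nat)%:Z - K%:Z).
apply: (@sub_finite_set _ _ (range g)); last exact/finite_image/finite_finset.
move=> c /= cK; exists [ffun i => inord `|(c i 0 + K%:Z)%R|%N] => //.
apply/colP => i; rewrite !mxE ffunE inordK; last by have := cK i; lia.
by have := cK i; lia.
Qed.

Section CrystalLattice.
Context (d : nat) (X : crystal_lattice d).

Lemma countable_period : countable [set: period X].
Proof.
have [b [g _ gK]] := period_free X.
apply/countable_injP; exists (fun a => pickle (g a)) => a a' _ _.
by move=> /(pcan_inj pickleK)/(can_inj gK).
Qed.

(** There are finitely many edge orbits, each an image of the countable group of periods. *)
Lemma countable_edge : countable [set: edge X].
Proof.
apply: (@sub_countable _ _ _ (\bigcup_(O in orbits (@actE _ X)) O)).
  apply: subset_card_le => e _; exists (orbit_of (@actE _ X) e); first by exists e.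
  by exists 0 => //; have [act0 _] := actE_action X.
apply: bigcup_countable.
  exact/finite_set_countable/(quotient_edges_finite X).
move=> _ [e _ <-]; apply: (sub_countable _ countable_period).
exact: card_image_le.
Qed.

Lemma actVK a : cancel (@actV _ X a) (actV (- a)).
Proof.
move=> x; have [act0 actD] := actV_action X.
by rewrite -actD addNr act0.
Qed.

Lemma actVKV a : cancel (@actV _ X (- a)) (actV a).
Proof. by move=> x; rewrite -{1}[a]opprK actVK. Qed.

End CrystalLattice.

Lemma is_path_cat (X : graph) (x y z : vertex X) p q :
  is_path x p y -> is_path y q z -> is_path x (p ++ q) z.
Proof.
elim: p x => [|e p IHp] x /= => [->//|[-> ep] qP].
by split=> //; exact: IHp.
Qed.

Lemma is_path_map (X : graph) (f : vertex X -> vertex X)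
    (h : edge X -> edge X) : (forall e, src (h e) = f (src e)) ->
    (forall e, tgt (h e) = f (tgt e)) ->
  forall x p y, is_path x p y -> is_path (f x) (map h p) (f y).
Proof.
move=> hs ht x p y; elim: p x => [|e p IHp] x /= => [->//|[<- /IHp pP]].
by rewrite hs ht.
Qed.

Section Realization.
Context (R : realType) (d : nat) (X : crystal_lattice d).
Implicit Types (Phi : vertex X -> 'cV[R]_d) (rho : period X -> 'cV[R]_d).

Lemma le_enorm (x : 'cV[R]_d) i : `|x i 0| <= enorm x.
Proof.
rewrite -sqrtr_sqr ler_wsqrtr// (bigD1 i)//= lerDl.
by apply: sumr_ge0 => j _; exact: sqr_ge0.
Qed.

Section Period.
Context Phi rho (hPhi : periodic_realization Phi rho).

Lemma rho_additive a b : rho (a + b) = rho a + rho b.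
Proof. by case: hPhi. Qed.

Lemma rho0 : rho 0 = 0.
Proof. by apply: (addrI (rho 0)); rewrite -rho_additive !addr0. Qed.

Lemma rhoN a : rho (- a) = - rho a.
Proof. by apply: (addrI (rho a)); rewrite -rho_additive !subrr rho0. Qed.

Lemma rhoMn a n : rho (a *+ n) = n%:R *: rho a.
Proof.
elim: n => [|n IHn]; first by rewrite scale0r rho0.
by rewrite mulrS rho_additive IHn -natr1 scalerDl scale1r addrC.
Qed.

Lemma Phi_act a x : Phi (actV a x) = Phi x + rho a.
Proof. by case: hPhi. Qed.

Lemma finite_bounded_periods (K : R) :
  finite_set [set a | forall i, `|rho a i 0| <= K].
Proof.
have [_ injrho [M [uM rangeM]] _] := hPhi.
(* [b] bounds every integer coordinate of such a period in the basis [M], since these coordinates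
   are the entries of [invmx M *m rho a]. *)
pose b := \sum_i \sum_j `|invmx M i j| * `|K|.
pose g (c : 'cV[int]_d) : period X :=
  xget 0 [set a | rho a = M *m map_mx intr c].
pose C := [set c : 'cV[int]_d | forall i, (`|c i 0%R|%N <= `|Num.ceil b|)%N].
have finC : finite_set (g @` C) by exact/finite_image/finite_bounded_int.
apply: sub_finite_set finC.
move=> a /= aK; have : range rho (rho a) by exists a.
rewrite rangeM => -[c _ Mc]; exists c; last first.
  rewrite /g; case: xgetP => [a' _ a'c|/(_ a)/(_ (esym Mc))//].
  by apply: injrho; rewrite -Mc.
move=> i.
have b0 : 0 <= b by do 2!apply: sumr_ge0 => ? _; exact: mulr_ge0.
have ceil0 : 0 <= Num.ceil b by rewrite ceil_ge0 (lt_le_trans _ b0) ?ltrN10.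
rewrite -lez_nat !abszE (ger0_norm ceil0) -(ler_int R) intr_norm.
apply: le_trans (ceil_ge b).
have -> : (c i 0)%:~R = (map_mx intr c : 'cV[R]_d) i 0 by rewrite mxE.
rewrite -(mulKmx uM (map_mx intr c)) Mc mxE.
apply: le_trans (ler_norm_sum _ _ _) _.
apply: (@le_trans _ _ (\sum_j `|invmx M i j| * `|K|)).
  apply: ler_sum => j _; rewrite normrM ler_wpM2l//.
  exact: le_trans (aK j) (ler_norm _).
rewrite /b [leRHS](bigD1 i)//= lerDl.
by do 2!apply: sumr_ge0 => ? _; exact: mulr_ge0.
Qed.

(** Within one of the finitely many orbits, a bounded position of [actV a x] bounds [rho a], leaving
    finitely many [a]. *)
Lemma finite_bounded_vertices (K : R) :
  finite_set [set x | forall i, `|Phi x i 0| <= K].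
Proof.
pose V_ O := O `&` [set x | forall i, `|Phi x i 0| <= K].
apply: (@sub_finite_set _ _ (\bigcup_(O in orbits (@actV _ X)) V_ O)).
  move=> x xK; exists (orbit_of (@actV _ X) x); first by exists x.
  by split=> //; exists 0 => //; have [act0 _] := actV_action X.
apply: bigcup_finite; first exact: quotient_vertices_finite.
move=> _ [x _ <-].
apply: (@sub_finite_set _ _ ((fun a => actV a x) @` [set a | forall i,
    `|rho a i 0| <= K + \sum_j `|Phi x j 0|])); last first.
  exact/finite_image/finite_bounded_periods.
move=> _ [[a _ <-] aK]; exists a => // i.
have := aK i; rewrite Phi_act mxE => aKi.
rewrite -[rho a i 0](addKr (Phi x i 0)) (le_trans (ler_normD _ _))// normrN addrC.
by rewrite lerD// (bigD1 i)//= lerDl sumr_ge0.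
Qed.

Lemma finite_fiber v : finite_set [set x | Phi x = v].
Proof.
apply: sub_finite_set (finite_bounded_vertices (\sum_j `|v j 0|)).
by move=> x /= -> i; rewrite (bigD1 i)//= lerDl sumr_ge0.
Qed.

(** The vertex [actV a v] competes for being nearest to [rho a], at distance [enorm (Phi v)].
    Translating the nearest vertex back by [a] therefore lands in a bounded set independent of
    [a]. *)
Lemma nearest_vertex_period closest : nearest_vertex Phi closest ->
  exists2 W : set (vertex X), finite_set W &
    forall a, exists2 u, W u & closest (rho a) = actV a u.
Proof.
move=> near; have [[v _] _] := lattice_connected X.
exists [set x | forall i, `|Phi x i 0| <= enorm (Phi v)].
  exact: finite_bounded_vertices.
move=> a; exists (actV (- a) (closest (rho a))); last by rewrite actVKV.
move=> i /=; apply: le_trans (le_enorm _ i) _.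
by have := near (rho a) (actV a v); rewrite !Phi_act rhoN addrK.
Qed.

(* Some multiple of A gamma is a period since A Phi(V) + b lies in Phi(V), which
   consists of finitely many translates of the period lattice. *)
Lemma rotated_period (A : 'M[R]_d) b (f : vertex X -> vertex X) :
  (forall x, A *m Phi x + b = Phi (f x)) ->
  forall a, exists2 n, (0 < n)%N & exists a', n%:R *: (A *m rho a) = rho a'.
Proof.
move=> fA a; have [[v _] _] := lattice_connected X.
pose O j := orbit_of (@actV _ X) (f (actV (a *+ j) v)).
have [j [j' [jj' [a' Ea']]]] : exists j j', (j < j')%N /\
    exists a', f (actV (a *+ j') v) = actV a' (f (actV (a *+ j) v)).
  (* Pigeonhole: otherwise [O] would inject the natural numbers into the finite set of vertex
     orbits. *)
  apply: contrapT => nex; apply: infinite_nat.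
  have injO j j' : (j < j')%N -> O j <> O j'.
    move=> jj' OO; apply: nex; exists j, j'; split=> //.
    have : O j' (f (actV (a *+ j') v)).
      by exists 0 => //; have [act0 _] := actV_action X.
    by rewrite -OO => -[a' _ <-]; exists a'.
  rewrite (_ : [set: nat] = O @^-1` orbits (@actV _ X)).
    apply: finite_preimage (quotient_vertices_finite X) => j j' _ _ OO.
    by case: (ltngtP j j') => // [/injO|/injO]; rewrite OO.
  by apply/seteqP; split=> // j _; exists (f (actV (a *+ j) v)).
exists (j' - j)%N; first by rewrite subn_gt0.
exists a'; have := congr1 Phi Ea'.
rewrite Phi_act -!fA !Phi_act !rhoMn !mulmxDr -!scalemxAr => E.
rewrite natrB ?(ltnW jj')// scalerBl.
apply/eqP; rewrite subr_eq; apply/eqP/(addIr b)/(addrI (A *m Phi v)).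
by rewrite addrA E -!addrA; congr (_ + _); rewrite [RHS]addrC -addrA.
Qed.

End Period.

(** Multiplying by the product of the denominators makes the coordinates integral; conversely the
    integer coordinates of a period are divided by [n]. *)
Lemma rational_points_period Phi rho (hPhi : periodic_realization Phi rho) x :
  rational_points rho x <->
  exists2 n, (0 < n)%N & exists a, n%:R *: x = rho a.
Proof.
split=> [[M [[uM rangeM] [q ->]]]|[n n0 [a xa]]].
  pose n := (\prod_i `|denq (q i 0%R)|)%N.
  have n0 : (0 < n)%N by rewrite prodn_gt0// => i; rewrite absz_gt0 denq_neq0.
  exists n => //.
  have qn i : {m : int | n%:R * (ratr (q i 0) : R) = m%:~R}.
    rewrite /n (bigD1 i)//= natrM.
    exists (numq (q i 0) * (\prod_(j | j != i) `|denq (q j 0%R)|)%N%:Z).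
    rewrite mulrAC rmorphM/= ; congr (_ * _).
    rewrite -[X in ratr X]divq_num_den rmorph_div/= ?unitfE ?intr_eq0 ?denq_neq0//.
    rewrite !ratr_int mulrC natr_absz gtr0_norm ?denq_gt0// divfK//.
    by rewrite intr_eq0 denq_neq0.
  have : range rho (n%:R *: (M *m map_mx ratr q)).
    rewrite rangeM; exists (\col_i sval (qn i)) => //.
    rewrite scalemxAr; congr (_ *m _); apply/colP => i.
    by rewrite !mxE; case: (qn i) => /= m ->.
  by move=> [a _ <-]; exists a.
have [_ _ [M [uM rangeM]] _] := hPhi.
have : range rho (rho a) by exists a.
rewrite rangeM => -[c _ Mc]; exists M; split=> //.
exists (\col_i ((c i 0)%:~R / n%:R)).
rewrite -[LHS](scalerK (a := n%:R)) ?pnatr_eq0 ?lt0n_neq0// xa -Mc.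
rewrite scalemxAr; congr (_ *m _); apply/colP => i.
by rewrite !mxE fmorph_div rmorph_int rmorph_nat mulrC.
Qed.

End Realization.

(** * Passage times *)

Section Fast.
Context (R : realType) (X : graph).

(** The event that the passage time is below [a], stated through a witnessing path and for
    deterministic weights, so that paths can be concatenated and edges relabelled. *)
Definition fast (tau : edge X -> R) (x y : vertex X) (a : R) : Prop :=
  exists2 p, is_path x p y & \sum_(e <- p) tau e < a.

Lemma fastD tau x y z a b :
  fast tau x y a -> fast tau y z b -> fast tau x z (a + b).
Proof.
move=> [p pP pa] [q qP qb]; exists (p ++ q); first exact: is_path_cat pP qP.
by rewrite big_cat ltrD.
Qed.

Lemma measurable_fast d (T : measurableType d) (s : edge X -> T -> R) x y a :
  countable [set: edge X] -> (forall e, measurable_fun setT (s e)) ->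
  measurable [set w | fast (s^~ w) x y a].
Proof.
move=> cE ms; rewrite (_ : [set w | _] =
    \bigcup_p [set w | is_path x p y /\ \sum_(e <- p) s e w < a]); last first.
  apply/seteqP; split=> w [p]; first by move=> xy pa; exists p.
  by move=> _ [xy pa]; exists p.
apply: countable_bigcupT_measurable; first exact: countable_seq.
move=> p; have [xy|nxy] := pselect (is_path x p y); last first.
  by rewrite (_ : [set w | _] = set0)//; apply/seteqP; split=> // w [].
rewrite (_ : [set w | _] = (fun w => \sum_(e <- p) s e w) @^-1` `]-oo, a[).
  by rewrite -[X in measurable X]setTI; exact: measurable_sum.
apply/seteqP; split=> w /=; first by move=> [_]; rewrite in_itv.
by rewrite in_itv.
Qed.

(** [r] picks one representative of each undirected edge: [e] and [rev e] define the same
    two-element predicate, on which [choose] gives a common value. *)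
Lemma orientation_exists : exists r : edge X -> edge X,
  (forall e, r e = e \/ r e = Defs.rev e) /\ (forall e, r (Defs.rev e) = r e).
Proof.
exists (fun e => choose (pred2 e (Defs.rev e)) e); split=> e.
  have : pred2 e (Defs.rev e) (choose (pred2 e (Defs.rev e)) e).
    by rewrite chooseP//= eqxx.
  by case/orP=> /eqP; [left|right].
have revE : pred2 (Defs.rev e) (Defs.rev (Defs.rev e)) =1 pred2 e (Defs.rev e).
  by move=> e' /=; rewrite Defs.revK orbC.
by rewrite (eq_choose revE); apply: choose_id; rewrite /= ?eqxx ?orbT.
Qed.

Context (dT : measure_display) (T : measurableType dT) (P : probability T R).

Lemma passage_time_lt (t : edge X -> {RV P >-> R}) x y w a :
  (passage_time t x y w < a%:E)%E <-> fast (fun e => t e w) x y a.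
Proof.
split=> [/ereal_inf_lt[_ [p xy <-]]|[p xy pa]]; first by rewrite lte_fin; exists p.
apply: le_lt_trans (_ : (\sum_(e <- p) t e w)%:E < _)%E; last by rewrite lte_fin.
by apply: ereal_inf_lbound; exists p.
Qed.

Lemma iid_on_comp nu (D : set (edge X)) (h : edge X -> edge X)
    (t : edge X -> {RV P >-> R}) : bijective h ->
  iid_on nu (h @` D) t -> iid_on nu D (t \o h).
Proof.
move=> [g hK gK] [lawt indt]; split=> [e De B mB|s us sD B mB].
  by apply: lawt => //; exists e.
have ums : uniq (map h s) by rewrite map_inj_uniq //; exact: can_inj hK.
have msD : [set` map h s] `<=` h @` D.
  by move=> e /= /mapP[e' e's ->]; exists e' => //; exact: sD.
have := indt _ ums msD (B \o g) (fun i => mB (g i)).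
rewrite big_map (_ : \bigcap_(i in _) _ =
    \bigcap_(i in [set` s]) ((t \o h) i @^-1` B i)) => [->|].
  by apply: eq_bigr => e _ /=; rewrite hK.
apply/seteqP; split=> w Bw e /=.
  by move=> es; have := Bw (h e) (map_f h es); rewrite /= hK.
by case/mapP => e' e's ->; rewrite hK; exact: Bw.
Qed.

Lemma fast_law nu (t : edge X -> {RV P >-> R}) (h : edge X -> edge X) x y a :
  countable [set: edge X] -> iid_passage_times nu t -> bijective h ->
  (forall e, h (Defs.rev e) = Defs.rev (h e)) ->
  P [set w | fast (fun e => t e w) x y a] =
  P [set w | fast (fun e => t (h e) w) x y a].
Proof.
move=> cE [trev iidt] bijh hrev; have [r [r_or r_rev]] := orientation_exists.
pose D := range r.
have rr e : r (r e) = r e by case: (r_or e) => E; rewrite {1}E ?r_rev.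
have Drev e : D e -> ~ D (Defs.rev e).
  move=> [e0 _ <-] [e1 _ E]; have := rr e1; rewrite E r_rev rr => /esym.
  exact: rev_neq.
have hDrev e : (h @` D) e -> ~ (h @` D) (Defs.rev e).
  move=> [e0 De0 <-] [e1 De1]; rewrite -hrev => /(bij_inj bijh) E.
  by apply: (Drev e0 De0); rewrite -E.
pose C := [set tau : edge X -> R | fast (tau \o r) x y a].
(* Composing with [r] makes [C] depend on coordinates in [D] only. *)
have mC : <<s @cylinders R _ D >> C.
  apply: (@measurable_fast _ (g_sigma_algebraType (@cylinders R _ D))
    (fun e tau => tau (r e))) => // e.
  by apply: measurable_coordinate; exists e.
have tr e w : t (r e) w = t e w by case: (r_or e) => ->; rewrite ?trev.
have thr e w : t (h (r e)) w = t (h e) w.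
  by case: (r_or e) => ->; rewrite ?hrev ?trev.
have := iid_on_law (iidt D Drev) (iid_on_comp bijh (iidt _ hDrev)) mC.
by congr (P _ = P _); apply/funext => w; congr (fast _ x y a);
  apply/funext => e; rewrite /process /= ?tr ?thr.
Qed.

End Fast.

(** * Passage times along translates of a fixed path *)

Section Translates.
Context (R : realType) (d : nat) (X : crystal_lattice d).
Context (dT : measure_display) (T : measurableType dT) (P : probability T R).
Context (nu : probability (measurableTypeR R) R) (t : edge X -> {RV P >-> R}).
Context (ht : iid_passage_times nu t).

Lemma passage_law e (B : set R) : measurable B -> P (t e @^-1` B) = nu B.
Proof.
move=> mB; have [_ iidt] := ht.
have De e' : [set e] e' -> ~ [set e] (Defs.rev e') by move=> -> /rev_neq.
by have [lawt _] := iidt _ De; apply: lawt.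
Qed.

Lemma measurable_le_sum (p : seq (edge X)) (h : edge X -> edge X) (c : R) :
  measurable [set w | c <= \sum_(e <- p) t (h e) w].
Proof.
rewrite (_ : [set w | _] = (fun w => \sum_(e <- p) t (h e) w) @^-1` `[c, +oo[).
  by rewrite -[X in measurable X]setTI; exact: measurable_sum.
by apply/seteqP; split=> w /=; rewrite in_itv/= andbT.
Qed.

(** A single translated edge has the law of the fixed edge [e], whose finite time is eventually
    below any positive multiple of [k]. Longer paths follow by induction, halving [c] at each
    edge. *)
Lemma vanishing_translates a (p : seq (edge X)) (c : R) : 0 < c ->
  vanishing P (fun k =>
    [set w | c * k%:R <= \sum_(e <- p) t (actE (a *+ k) e) w]).
Proof.
elim: p c => [|e p IHp] c c0.
  apply: vanishing_eventually => [k|w]; first exact: measurable_le_sum.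
  near=> k; rewrite /= big_nil; apply/negP; rewrite -ltNge mulr_gt0// ltr0n.
  by near: k; exact: nbhs_infty_gt.
have c2 : 0 < c / 2 by rewrite divr_gt0.
have m1 (k : nat) (e' : edge X) : measurable [set w | c / 2 * k%:R <= t e' w].
  by have := measurable_le_sum [:: e'] id (c / 2 * k%:R);
    under eq_fun do rewrite big_seq1.
have ve : vanishing P (fun k => [set w | c / 2 * k%:R <= t (actE (a *+ k) e) w]).
  have : vanishing P (fun k => [set w | c / 2 * k%:R <= t e w]).
    apply: vanishing_eventually => // w.
    near=> k; apply/negP; rewrite -ltNge mulrC -ltr_pdivrMr//.
    by near: k; exact: nbhs_infty_gtr.
  apply: vanishing_le => //; apply: nearW => k.
  have preE e' : [set w | c / 2 * k%:R <= t e' w] =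
      t e' @^-1` `[c / 2 * k%:R, +oo[.
    by apply/seteqP; split=> w /=; rewrite in_itv/= andbT.
  by rewrite !preE !passage_law.
apply: vanishing_le (vanishingU ve (IHp _ c2)) => [k|].
  exact: measurable_le_sum.
apply: nearW => k; rewrite le_measure ?inE//.
- exact: measurable_le_sum.
- by apply: measurableU => //; exact: measurable_le_sum.
move=> w /=; rewrite big_cons => cs.
case: (leP (c / 2 * k%:R) (t (actE (a *+ k) e) w)) => [|lt1]; first by left.
by right; lra.
Unshelve. all: by end_near. Qed.

End Translates.

(** * Comparison of the time constants at [x] and [A *m x] for rational [x] *)

Section TimeConstant.
Context (R : realType) (d : nat) (X : crystal_lattice d).
Context (Phi Phi' : vertex X -> 'cV[R]_d) (rho : period X -> 'cV[R]_d).
Context (hPhi : periodic_realization Phi rho).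
Context (hPhi' : periodic_realization Phi' rho).
Context (closest : 'cV[R]_d -> vertex X) (hnear : nearest_vertex Phi' closest).
Context (A : 'M[R]_d) (b : 'cV[R]_d).
Context (f : vertex X -> vertex X) (fA : forall x, A *m Phi x + b = Phi (f x)).

Lemma rational_points_rotated x : rational_points rho x ->
  exists2 n, (0 < n)%N &
    exists a a', n%:R *: x = rho a /\ n%:R *: (A *m x) = rho a'.
Proof.
move=> /(rational_points_period hPhi)[n n0 [a xa]].
have [m m0 [a' aa']] := rotated_period hPhi fA a.
exists (m * n)%N; first by rewrite muln_gt0 m0.
exists (a *+ m), a'; split; first by rewrite (rhoMn hPhi) -xa scalerA natrM.
by rewrite -aa' -xa -scalemxAr scalerA natrM.
Qed.

Lemma rotated_nearest_vertex x : rational_points rho x ->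
  exists2 n, (0 < n)%N & exists (a : period X) (W : seq (vertex X)),
    forall k, exists w w', [/\ w \in W, w' \in W,
      f (closest ((n * k)%:R *: x)) = actV (a *+ k) w &
      closest ((n * k)%:R *: (A *m x)) = actV (a *+ k) w'].
Proof.
move=> /rational_points_rotated[n n0 [a [a' [xa Axa']]]]; exists n => //.
have [U finU Unear] := nearest_vertex_period hPhi' hnear.
(* [f] need not commute with translations and [Phi] may be degenerate: the vertex translated back
   shares its image with [f u] but may differ from it. Finiteness of the fibers suffices. *)
pose V := \bigcup_(u in U) [set v | Phi v = Phi (f u)].
have : finite_set (U `|` V).
  rewrite finite_setU; split=> //.
  by apply: bigcup_finite => // u _; exact: finite_fiber hPhi _.
move=> /finite_seqP[W UVW]; exists a', W => k.
have nkE y c : n%:R *: y = rho c -> (n * k)%:R *: y = rho (c *+ k).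
  by move=> yc; rewrite (rhoMn hPhi) -yc scalerA mulnC natrM.
rewrite (nkE _ _ xa) (nkE _ _ Axa').
have [u Uu ->] := Unear (a *+ k); have [u' Uu' ->] := Unear (a' *+ k).
exists (actV (- (a' *+ k)) (f (actV (a *+ k) u))), u'; split=> //.
- suff : [set` W] (actV (- (a' *+ k)) (f (actV (a *+ k) u))) by [].
  rewrite -UVW; right; exists u => //=.
  rewrite (Phi_act hPhi) -!fA (Phi_act hPhi) (rhoN hPhi) !(rhoMn hPhi) -xa -Axa'.
  by rewrite mulmxDr -!scalemxAr addrAC addrK.
- by suff : [set` W] u' by []; rewrite -UVW; left.
- by rewrite actVKV.
Qed.

Context (dT : measure_display) (T : measurableType dT) (P : probability T R).
Context (nu : probability (measurableTypeR R) R) (t : edge X -> {RV P >-> R}).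
Context (ht : iid_passage_times nu t).
Context (mu : 'cV[R]_d -> R) (hmu : time_constant rho t closest mu).
Context (h : edge X -> edge X) (fh : graph_automorphism f h).

Lemma rational_points_mulmx x : rational_points rho x ->
  rational_points rho (A *m x).
Proof.
move=> /rational_points_rotated[n n0 [_ [a' [_ Axa']]]].
by apply/(rational_points_period hPhi); exists n => //; exists a'.
Qed.

Lemma time_constant_subseq x n : (0 < n)%N -> rational_points rho x ->
  {ae P, forall w, (passage_time t (closest 0) (closest ((n * k)%:R *: x)) w *
    ((n * k)%:R^-1)%:E)%E @[k --> \oo] --> (mu x)%:E}.
Proof.
move=> n0 /(proj2 hmu); apply: filterS => w cvgw.
apply: cvg_trans cvgw.
have nk : (n * k)%N @[k --> \oo] --> \oo.
  move=> /= S [m _ mS]; exists m => // k /= mk; apply: mS => /=.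
  by rewrite (leq_trans mk)// leq_pmull.
by move=> S; apply: nk.
Qed.

(** If the inequality failed, four events of vanishing probability would cover the whole space for
    every [k]: outside the first, third and fourth, a concatenated path realizes the second. *)
Lemma time_constant_le_rational x : rational_points rho x ->
  mu (A *m x) <= mu x.
Proof.
move=> ratx; rewrite leNgt; apply/negP => ltmu.
have [n n0 [a [W hW]]] := rotated_nearest_vertex ratx.
have /choice[ww wwP] : forall k, exists ww : vertex X * vertex X,
    [/\ ww.1 \in W, ww.2 \in W,
      f (closest ((n * k)%:R *: x)) = actV (a *+ k) ww.1 &
      closest ((n * k)%:R *: (A *m x)) = actV (a *+ k) ww.2].
  by move=> k; have [w [w' ?]] := hW k; exists (w, w').
have [_ /(_ _ _)/cid paths] := lattice_connected X.
pose path u v := sval (paths u v).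
have pathP u v : is_path u (path u v) v by exact: (svalP (paths u v)).
have cE := countable_edge X.
have [_ bijh hsrc htgt hrev] := fh.
have mt (h' : edge X -> edge X) e : measurable_fun setT (t (h' e)).
  exact: measurable_funPT.
(* A quarter of the gap: the three legs cost rates [eps], [mu x + eps] and [eps], which add up to
   [mu (A *m x) - eps]. *)
pose eps := (mu (A *m x) - mu x) / 4.
have eps0 : 0 < eps by rewrite divr_gt0 ?subr_gt0.
pose r k : R := (n * k)%:R.
have r_gt0 : \forall k \near \oo, 0 < r k.
  by exists 1%N => // k /= k0; rewrite ltr0n muln_gt0 n0.
pose v := closest 0.
pose y k := closest (r k *: x); pose z k := closest (r k *: (A *m x)).
have mfast (h' : edge X -> edge X) u u' c :
    measurable [set w | fast (fun e => t (h' e) w) u u' c].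
  exact: (measurable_fast (s := fun e w => t (h' e) w) _ _ _ cE (mt h')).
have slow_x : vanishing P (fun k =>
    ~` [set w | fast (t^~ w) v (y k) ((mu x + eps) * r k)]).
  apply: vanishing_ae => [k|].
    exact/measurableC/(mfast id).
  have := time_constant_subseq n0 ratx; apply: filterS => w cvgw.
  have := cvgw [set u | (u < (mu x + eps)%:E)%E] _.
  have /open_ereal_lt' lt_eps : ((mu x)%:E < (mu x + eps)%:E)%E.
    by rewrite lte_fin ltrDl.
  move=> /(_ lt_eps); apply: filterS2 r_gt0 => k rk0 /=.
  by rewrite lte_pdivrMr// -EFinM => /passage_time_lt fk /(_ fk).
(* Relabelling the edges by [h] preserves each probability, which carries the estimate from [t] to
   [t \o h]. *)
have slow_hx : vanishing P (fun k =>
    ~` [set w | fast (fun e => t (h e) w) v (y k) ((mu x + eps) * r k)]).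
  apply: vanishing_le slow_x => [k|]; first exact: measurableC.
  apply: nearW => k; rewrite !probability_setC ?(mfast id)//.
  by rewrite (fast_law _ _ _ cE ht bijh hrev).
have fast_Ax : vanishing P (fun k =>
    [set w | fast (t^~ w) v (z k) ((mu (A *m x) - eps) * r k)]).
  apply: vanishing_ae => [k|]; first exact: (mfast id).
  have := time_constant_subseq n0 (rational_points_mulmx ratx).
  apply: filterS => w cvgw.
  have := cvgw [set u | ((mu (A *m x) - eps)%:E < u)%E] _.
  have /open_ereal_gt' gt_eps : ((mu (A *m x) - eps)%:E < (mu (A *m x))%:E)%E.
    by rewrite lte_fin ltrBlDr ltrDl.
  move=> /(_ gt_eps); apply: filterS2 r_gt0 => k rk0 /=.
  rewrite lte_pdivlMr// -EFinM => lt_T /(passage_time_lt t).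
  by move=> /(lt_trans lt_T); rewrite ltxx.
have far_start : vanishing P (fun k =>
    [set w | eps * r k <= \sum_(e <- path v (f v)) t e w]).
  apply: vanishing_eventually => [k|w]; first exact: (measurable_le_sum _ _ id).
  near=> k; apply/negP; rewrite -ltNge mulrC -ltr_pdivrMr//.
  have rk : k%:R <= r k by rewrite ler_nat leq_pmull.
  apply: lt_le_trans rk.
  by near: k; exact: nbhs_infty_gtr.
have far_end : vanishing P (fun k => [set w | eps * r k <=
    \sum_(e <- path (ww k).1 (ww k).2) t (actE (a *+ k) e) w]).
  (* The pair [ww k] varies with [k] but stays in the finite list of pairs from [W], so it is enough
     to treat each fixed pair. *)
  pose F (i : vertex X * vertex X) k := [set w | eps * r k <=
    \sum_(e <- path i.1 i.2) t (actE (a *+ k) e) w].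
  apply: (@vanishing_finite _ _ _ P _ [seq (u, u') | u <- W, u' <- W] F ww).
    move=> i _; have := vanishing_translates ht a (path i.1 i.2) (c := eps * n%:R).
    rewrite mulr_gt0 ?ltr0n// => /(_ isT).
    by rewrite /F /r; under eq_fun do under eq_set do rewrite -mulrA -natrM.
  move=> k; have [w1 w2 _ _] := wwP k.
  by apply/allpairsP; exists (ww k); rewrite -surjective_pairing.
have [_ /(_ 1 ltr01)] :=
  vanishingU (vanishingU slow_hx fast_Ax) (vanishingU far_start far_end).
move=> /filter_ex[k]; rewrite (_ : _ `|` _ = setT).
  by rewrite probability_setT ltxx.
apply/seteqP; split=> // w _.
apply: contrapT => nw.
have hx : fast (fun e => t (h e) w) v (y k) ((mu x + eps) * r k).
  by apply: contrapT => nhx; apply: nw; left; left.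
have start : fast (t^~ w) v (f v) (eps * r k).
  exists (path v (f v)) => //; rewrite ltNge; apply/negP => ?.
  by apply: nw; right; left.
have end_ : fast (t^~ w) (f (y k)) (z k) (eps * r k).
  have [_ _ -> zk] := wwP k; rewrite (zk : z k = _).
  exists (map (actE (a *+ k)) (path (ww k).1 (ww k).2)).
    exact: (is_path_map (act_src _) (act_tgt _)).
  by rewrite big_map ltNge; apply/negP => ?; apply: nw; right; right.
(* A path that is fast for the relabelled times is mapped by [h] to one that is fast for [t] between
   the images under [f]. *)
have fhx : fast (t^~ w) (f v) (f (y k)) ((mu x + eps) * r k).
  have [p vp pa] := hx; exists (map h p); first exact: is_path_map.
  by rewrite big_map.
apply: nw; left; right => /=.
rewrite (_ : _ * _ = eps * r k + (mu x + eps) * r k + eps * r k).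
  exact: fastD (fastD start fhx) end_.
by rewrite -!mulrDl; congr (_ * _); rewrite /eps; lra.
Unshelve. all: by end_near. Qed.

End TimeConstant.

(** * From rational points to all points, by density and continuity *)

Lemma continuous_mulmx (R : realType) m n p (A : 'M[R]_(m, n)) :
  continuous (mulmx A : 'M[R]_(n, p) -> 'M[R]_(m, p)).
Proof.
move=> x; have FF := @nbhs_filter _ x; apply/cvg_ballP => e e0.
near=> y; split=> //; near: y.
apply: filter_forall => i; apply: filter_forall => j.
have : (fun y : 'M[R]_(n, p) => (A *m y) i j) @ x --> (A *m x) i j.
  under eq_cvg do rewrite mxE; rewrite mxE.
  apply: (@cvg_big _ _ _ _ (fun=> true) add_continuous) => k _.
  by apply: cvgMr; exact: coord_continuous.
by move/cvg_ballP; apply.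
Unshelve. all: by end_near. Qed.

(** The coordinates of [x] in the basis [M] are approximated by rationals, and multiplication by [M]
    is continuous. *)
Lemma rational_points_dense (R : realType) d (X : crystal_lattice d)
    (rho : period X -> 'cV[R]_d) M : lattice_basis rho M ->
  forall (x : 'cV[R]_d) (U : set 'cV[R]_d), nbhs x U ->
    exists2 y, rational_points rho y & U y.
Proof.
move=> bM x U xU; have [uM _] := bM.
have : nbhs (invmx M *m x) (mulmx M @^-1` U).
  by apply: continuous_mulmx; rewrite mulKVmx.
case/nbhs_ballP => e /= e0 eU.
have /choice[q qP] (i : 'I_d) : exists q : rat,
    `|(invmx M *m x) i 0 - ratr q| < e.
  have := @rat_in_itvoo R ((invmx M *m x) i 0) ((invmx M *m x) i 0 + e).
  rewrite ltrDl => /(_ e0)[q]; rewrite in_itv/= => /andP[q1 q2]; exists q.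
  by rewrite distrC ger0_norm ?subr_ge0 ?ltW// ltrBlDl.
pose y := map_mx ratr (\col_i q i) : 'cV[R]_d.
exists (M *m y); first by exists M; split=> //; exists (\col_i q i).
apply: eU; split=> // i j; rewrite ord1 /y !mxE.
by have := qP i; rewrite mxE.
Qed.

Section TimeConstantSymmetry.
Context (R : realType) (d : nat) (X : crystal_lattice d).
Context (Phi Phi' : vertex X -> 'cV[R]_d) (rho : period X -> 'cV[R]_d).
Context (hPhi : periodic_realization Phi rho).
Context (hPhi' : periodic_realization Phi' rho).
Context (closest : 'cV[R]_d -> vertex X) (hnear : nearest_vertex Phi' closest).
Context (dT : measure_display) (T : measurableType dT) (P : probability T R).
Context (nu : probability (measurableTypeR R) R) (t : edge X -> {RV P >-> R}).
Context (ht : iid_passage_times nu t).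
Context (mu : 'cV[R]_d -> R) (hmu : time_constant rho t closest mu).

(** A strict failure at [x] would persist on a neighbourhood, which contains a rational point. *)
Lemma time_constant_le (A : 'M[R]_d) b f h : graph_automorphism f h ->
  (forall x, A *m Phi x + b = Phi (f x)) -> forall x, mu (A *m x) <= mu x.
Proof.
move=> fh fA x; rewrite leNgt; apply/negP => ltmu.
have [_ _ [M bM] _] := hPhi; have [cmu _] := hmu.
have cA : mu (A *m y) @[y --> x] --> mu (A *m x).
  by apply: continuous_comp; [exact: continuous_mulmx|exact: cmu].
have [|y ratyP /=] := rational_points_dense bM (x := x)
    (U := [set y | mu y < mu (A *m y)]).
  near=> y; apply: (@lt_trans _ _ ((mu x + mu (A *m x)) / 2)).
    near: y; apply: cvgr_lt (cmu x) _ _; lra.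
  near: y; apply: cvgr_gt cA _ _; lra.
rewrite ltNge.
by rewrite (time_constant_le_rational hPhi hPhi' hnear fA ht hmu fh ratyP).
Unshelve. all: by end_near. Qed.

End TimeConstantSymmetry.

(** * Inverse symmetries and invariance of the limit shape *)

Lemma graph_automorphism_inv (X : graph) (f : vertex X -> vertex X)
    (h : edge X -> edge X) : graph_automorphism f h ->
  exists g k, [/\ graph_automorphism g k, cancel f g & cancel g f].
Proof.
move=> [[g fK gK] [k hK kK] hsrc htgt hrev]; exists g, k; split=> //; split.
- by exists f.
- by exists h.
- by move=> e; apply: (can_inj fK); rewrite gK -hsrc kK.
- by move=> e; apply: (can_inj fK); rewrite gK -htgt kK.
- by move=> e; apply: (can_inj hK); rewrite kK hrev kK.
Qed.

Theorem proposition3p5 (R : realType) (d : nat) (X : crystal_lattice d)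
    (Phi : vertex X -> 'cV[R]_d) (rho : period X -> 'cV[R]_d)
    (hPhi : periodic_realization Phi rho)
    (nu : probability (measurableTypeR R) R)
    (hnu : nu [set x : R | 0 <= x] = 1%E)
    (l : nat) (hl : edge_connectivity X l)
    (hmoment : finite_min_moment nu l d)
    (dT : measure_display) (T : measurableType dT) (P : probability T R)
    (t : edge X -> {RV P >-> R}) (ht : iid_passage_times nu t)
    (B : set 'cV[R]_d) (hB : limit_shape Phi rho t B)
    (A : 'M[R]_d) (hA : point_symmetries Phi A) :
  [set A *m x | x in B] = B.
Proof.
(* The limit shape is computed with [Phi'], while the symmetry concerns [Phi]; the two share only
   the period homomorphism when [Phi] is degenerate. *)
have [Phi' [closest [mu [[hPhi' _] _ hnear hmu ->]]]] := hB.
have [[b A'] [/= orthA _ [f [h [fh fA]]]] /= AE] := hA.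
rewrite /congruent_transformations /= AE in orthA.
rewrite /move /= AE in fA.
have orthA' := mulmx1C orthA.
have [g [k [gk fK gK]]] := graph_automorphism_inv fh.
(* The inverse motion is realized by the inverse automorphism; its linear part [A^T] provides the
   reverse inclusion. *)
have gA x : A^T *m Phi x + - (A^T *m b) = Phi (g x).
  by rewrite -{1}(gK x) -fA mulmxDr mulmxA orthA' mul1mx addrK.
have muA := time_constant_le hPhi hPhi' hnear ht hmu fh fA.
have muAT := time_constant_le hPhi hPhi' hnear ht hmu gk gA.
apply/seteqP; split=> [_ [x /= mux <-]|x /= mux].
  exact: le_trans (muA x) mux.
exists (A^T *m x); first exact: le_trans (muAT x) mux.
by rewrite mulmxA orthA mul1mx.
Qed.
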